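(* Let $p$ be an odd prime, $L=\mathbb F_{p^m}$, $\sigma=p^s$ with $0<s<m$, and let $l,n,N\in L^*$ be such that $-l\notin L^{\sigma-1}$ and $x^{\sigma+1}+(1-1/N)x+(1/n-1)/N\ne0$ for all $x\in L$. Then the presemifield $B(p,m,s,l,n,N)$ is isotopic to a commutative semifield if and only if there is $v=(v_0,v_1)\in L^2$, $v\neq 0$, such that, with $f=nv_0+lnv_0^{\sigma}-lnNv_1^{\sigma}$, the following equations hold: $$lf^{\sigma}=nNv_0+lnNv_0^{\sigma}-nNv_1,\qquad v_0=lv_0^{\sigma}+nv_1-lnNv_1^{\sigma}.$$ In particular, such a $v$ exists when either (i) $N^2=n^{\sigma-1}$ and $l\in(1/N)L^{\sigma-1}$, or (ii) $N=n^{\sigma-1}$ and $l\in L^{\sigma-1}$.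
   Context: A finite presemifield $(F,+,* )$ is a finite abelian group $(F,+)$ with a multiplication satisfying both distributive laws and such that $x*y=0$ implies $x=0$ or $y=0$; a semifield is a presemifield with a multiplicative identity. Two presemifields $(F,+,* )$, $(F',+,*')$ are isotopic if there are additive group isomorphisms $A,B,C\colon F\to F'$ with $A(x)*'B(y)=C(x*y)$ for all $x,y$. For an integer $k\ge0$, $L^k=\{x^k:x\in L\}$. Under the stated conditions on $l,n,N$, the presemifield $B(p,m,s,l,n,N)$ is the additive group $L^2$ with multiplication $(a,b)*(c,d)=(h(a,b,c,d),\,ad+bc)$, where $$h(a,b,c,d)=ac^{\sigma}-nNbd^{\sigma}+l(a^{\sigma}c-nNb^{\sigma}d)+n\{Nad^{\sigma}-bc^{\sigma}+l(a^{\sigma}d-Nb^{\sigma}c)\}.$$ *)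

(* Defs.v *)
From HB Require Import structures.
From mathcomp Require Import all_boot all_order all_algebra all_field.
From mathcomp Require Import ring.

Set Implicit Arguments.
Unset Strict Implicit.
Unset Printing Implicit Defensive.

Import GRing.Theory.
Local Open Scope ring_scope.

(* Products get finType and zmodType instances from the library, not the join. *)
HB.instance Definition _ (A B : finZmodType) := GRing.Zmodule.on (A * B)%type.

Record presemifield := Presemifield {
  psf_group :> finZmodType;
  psf_mul : psf_group -> psf_group -> psf_group;
  psf_mulDl : left_distributive psf_mul +%R;
  psf_mulDr : right_distributive psf_mul +%R;
  psf_mul_eq0 : forall x y, psf_mul x y = 0 -> x = 0 \/ y = 0
}.

Definition is_semifield (F : presemifield) : Prop :=
  exists e : F, left_id e (@psf_mul F) /\ right_id e (@psf_mul F).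

Definition is_commutative (F : presemifield) : Prop :=
  commutative (@psf_mul F).

Definition isotopic (F F' : presemifield) : Prop :=
  exists A B C : {additive F -> F'},
    [/\ bijective A, bijective B, bijective C
      & forall x y : F, psf_mul (A x) (B y) = C (psf_mul x y)].

Definition isotopic_to_commutative_semifield (F : presemifield) : Prop :=
  exists F' : presemifield,
    [/\ is_semifield F', is_commutative F' & isotopic F F'].

(* All k-th powers of elements of L, hence containing 0 when k > 0. *)
Definition powers (L : finFieldType) (k : nat) : {set L} :=
  [set x ^+ k | x : L].

Definition B_h (L : finFieldType) (sigma : nat) (l n N a b c d : L) : L :=
  a * c ^+ sigma - n * N * b * d ^+ sigma
  + l * (a ^+ sigma * c - n * N * b ^+ sigma * d)
  + n * (N * a * d ^+ sigma - b * c ^+ sigma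
         + l * (a ^+ sigma * d - N * b ^+ sigma * c)).

Definition B_mul (L : finFieldType) (sigma : nat) (l n N : L)
    (x y : L * L) : L * L :=
  (B_h sigma l n N x.1 x.2 y.1 y.2, x.1 * y.2 + x.2 * y.1).

Lemma frobenius_exprD (p m s : nat) (L : finFieldType) :
  prime p -> #|L| = (p ^ m)%N ->
  forall x y : L, (x + y) ^+ (p ^ s) = x ^+ (p ^ s) + y ^+ (p ^ s).
Proof.
move=> p_prime card_L x y; have pL := card_finPcharP card_L p_prime.
by rewrite exprDn_pchar // (eq_pnat _ (pcharf_eq pL)) pnatX pnat_id.
Qed.

Lemma B_mulDl (p m s : nat) (L : finFieldType) (l n N : L) :
  prime p -> #|L| = (p ^ m)%N -> left_distributive (B_mul (p ^ s) l n N) +%R.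
Proof.
move=> p_prime card_L [a b] [a' b'] [c d].
rewrite /B_mul /B_h /= !(frobenius_exprD s p_prime card_L).
by congr (_, _) => /=; ring.
Qed.

Lemma B_mulDr (p m s : nat) (L : finFieldType) (l n N : L) :
  prime p -> #|L| = (p ^ m)%N -> right_distributive (B_mul (p ^ s) l n N) +%R.
Proof.
move=> p_prime card_L [a b] [c d] [c' d'].
rewrite /B_mul /B_h /= !(frobenius_exprD s p_prime card_L).
by congr (_, _) => /=; ring.
Qed.

(* If ad + bc = 0 with (a, b) != 0 then (c, d) = t (a, -b), and h factors as
   (t^sigma + l t) (a^(sigma+1) - n a^sigma b - nN a b^sigma + nN b^(sigma+1));
   a zero (a, b) != 0 of the second factor has a != 0, and then b / a - 1 is a
   root of the polynomial excluded by no_root. *)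
Lemma B_mul_eq0 (p m s : nat) (L : finFieldType) (l n N : L) :
  prime p -> #|L| = (p ^ m)%N -> n != 0 -> N != 0 ->
  - l \notin powers L (p ^ s - 1) ->
  (forall x : L,
     x ^+ (p ^ s + 1) + (1 - N^-1) * x + (n^-1 - 1) / N != 0) ->
  forall x y : L * L, B_mul (p ^ s) l n N x y = 0 -> x = 0 \/ y = 0.
Proof.
move=> p_prime card_L n0 N0 l_notin no_root [a b] [c d].
set q := (p ^ s)%N in l_notin no_root *.
have frobD : forall x y : L, (x + y) ^+ q = x ^+ q + y ^+ q.
  exact: frobenius_exprD p_prime card_L.
have q_gt0 : (0 < q)%N by rewrite expn_gt0 prime_gt0.
have frob0 : (0 : L) ^+ q = 0 by rewrite expr0n; case: (q) q_gt0.
have frobN : forall x : L, (- x) ^+ q = - x ^+ q.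
  by move=> x; apply/eqP; rewrite -addr_eq0 -frobD addNr frob0.
have [-> |ab0 eq0] := eqVneq (a, b) 0; first by left.
right; case: eq0; rewrite /= => h0 ad.
have [t ct dt] : exists2 t, c = t * a & d = - (t * b).
  have [a0|a0] := eqVneq a 0.
    have b0 : b != 0.
      by apply: contraNneq ab0 => ->; rewrite a0.
    exists (- (d / b)); last by rewrite mulNr opprK divfK.
    move: ad; rewrite a0 mul0r add0r mulr0 => /eqP.
    by rewrite mulf_eq0 (negPf b0) => /eqP.
  exists (c / a); rewrite ?divfK //.
  apply: (mulfI a0); apply/eqP; rewrite -subr_eq0 mulrN opprK.
  by rewrite mulrA [a * (c / a)]mulrC divfK // [c * b]mulrC ad.
have [t0|t0] := eqVneq t 0; first by rewrite ct dt t0 !mul0r oppr0.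
have {h0} /eqP : (t ^+ q + l * t) *
   (a ^+ q * a - n * a ^+ q * b - n * N * a * b ^+ q + n * N * b ^+ q * b) = 0.
  by rewrite -h0 /B_h ct dt frobN !exprMn; ring.
rewrite mulf_eq0 => /orP [/eqP tl | /eqP P0].
  case/negP: l_notin; apply/imsetP; exists t => //.
  apply: (mulIf t0); rewrite mulNr -exprSr subn1 prednK //.
  by apply/eqP; rewrite eq_sym -addr_eq0 tl.
have nN0 : n * N != 0 by rewrite mulf_neq0.
have [a0|a0] := eqVneq a 0.
  have b0 : b != 0 by apply: contraNneq ab0 => ->; rewrite a0.
  move: P0; rewrite a0 frob0 !(mul0r, mulr0) !(subr0, add0r) => /eqP.
  by rewrite -mulrA -exprSr mulf_eq0 (negPf nN0) expf_eq0 (negPf b0) andbF.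
have [y by_] : exists y, b = y * a by exists (b / a); rewrite divfK.
have Q0 : 1 - n * y - n * N * y ^+ q + n * N * y ^+ q * y = 0.
  apply: (mulIf (mulf_neq0 (expf_neq0 q a0) a0)); rewrite mul0r -[RHS]P0.
  by rewrite by_ exprMn; ring.
case/negP: (no_root (y - 1)); apply/eqP.
rewrite exprD expr1 frobD frobN expr1n.
have -> : (y ^+ q - 1) * (y - 1) + (1 - N^-1) * (y - 1) + (n^-1 - 1) / N
        = (1 - n * y - n * N * y ^+ q + n * N * y ^+ q * y) / (n * N).
  by field; rewrite n0 N0.
by rewrite Q0 mul0r.
Qed.

Definition B (p m s : nat) (L : finFieldType) (l n N : L)
    (p_prime : prime p) (card_L : #|L| = (p ^ m)%N)
    (n_neq0 : n != 0) (N_neq0 : N != 0)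
    (l_notin : - l \notin powers L (p ^ s - 1))
    (no_root : forall x : L,
       x ^+ (p ^ s + 1) + (1 - N^-1) * x + (n^-1 - 1) / N != 0) :
    presemifield :=
  @Presemifield (L * L)%type (B_mul (p ^ s) l n N)
    (B_mulDl s l n N p_prime card_L) (B_mulDr s l n N p_prime card_L)
    (B_mul_eq0 p_prime card_L n_neq0 N_neq0 l_notin no_root).

Definition B_commutativity_eqs (L : finFieldType) (sigma : nat) (l n N : L)
    (v : L * L) : Prop :=
  let f := n * v.1 + l * n * v.1 ^+ sigma - l * n * N * v.2 ^+ sigma in
  l * f ^+ sigma = n * N * v.1 + l * n * N * v.1 ^+ sigma - n * N * v.2
  /\ v.1 = l * v.1 ^+ sigma + n * v.2 - l * n * N * v.2 ^+ sigma.

(* Main.v *)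
Require Import Defs.
From HB Require Import structures.
From mathcomp Require Import all_boot all_order all_algebra all_field.
From mathcomp Require Import ring.

(** The starting point is a criterion of Ganley type: a presemifield (F, +, * )
    is isotopic to a commutative semifield exactly when some additive bijection
    T of F makes T x * y symmetric in x and y
    ([isotopic_to_commutative_semifieldP]).

    For the presemifield at hand, the second coordinate of the product is the
    L-bilinear symmetric form x.1 y.2 + x.2 y.1.  Since it is nondegenerate
    and T x pairs L-linearly with y, symmetry of T x * y there forces T to be
    L-linear, with a matrix given by three scalars a, b, c
    ([symmetric_twist]).  The first coordinate of T x * y is then a
    combination of the monomials x_i^sigma y_j and x_i y_j^sigma, which are
    linearly independent because sigma is a nontrivial automorphism of L.
    Symmetry means four equations between coefficients; one of them follows
    from the other three, one of them expresses c through (b, a), and the two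
    remaining ones are the stated equations for v = (b, a)
    ([twist_symmetricP]).  If such a T kills a nonzero x, then
    T y * x = T x * y = 0 for all y, so T = 0: thus T is bijective as soon as
    v != 0.

    For the two special families, replacing v by v / z multiplies the admissible
    l by z^(sigma - 1) ([B_commutativity_eqs_scale]), which reduces them to
    l = 1 / N and to l = 1.  In the first case v = (0, 1) is a solution
    ([B_commutativity_eqs_invN]).  In the
    second one the equations say that v = (b, (b - c) / n) with c fixed by
    sigma and b a solution of an inhomogeneous additive equation
    phi b = (n^(sigma - 1) - 1) c.  As L is finite, phi either is onto, and
    c = 1 is allowed, or has a nonzero kernel, and c = 0 will do
    ([B_commutativity_eqs_one]). *)

Import GRing.Theory.
Local Open Scope ring_scope.

(** * Presemifields isotopic to commutative semifields *)

Lemma additive_of_morph {U V : zmodType} {f : U -> V} :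
  {morph f : x y / x + y} -> exists g : {additive U -> V}, g =1 f.
Proof.
move=> fD; have f0 : f 0 = 0 by apply: (addrI (f 0)); rewrite -fD !addr0.
have fB : zmod_morphism f.
  move=> x y; apply: (addIr (f y)).
  by rewrite -fD !subrK.
pose m := GRing.isZmodMorphism.Build U V f fB.
pose g : {additive U -> V} := HB.pack f m.
by exists g.
Qed.

(** If (A, B, C) is an isotopism onto a commutative presemifield, then
    T = A^-1 B works.  Conversely x o y = T x * y is a commutative
    presemifield; Kaplansky's trick gives it an identity: with M x = x o e, the
    product M^-1 x o M^-1 y has the identity e o e. *)
Lemma isotopic_to_commutative_semifieldP (F : presemifield) :
  isotopic_to_commutative_semifield F <->
  exists T : {additive F -> F},
    injective T /\ forall x y, psf_mul (T x) y = psf_mul (T y) x.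
Proof.
split=> [[F' [_ F'C [A [B [C [bijA bijB bijC ABC]]]]]]|[T [T_inj TC]]].
  have [A' AK KA] := bijA.
  have TD : {morph A' \o B : x y / x + y}.
    move=> x y /=; apply: (bij_inj bijA).
    by rewrite KA !raddfD !KA.
  have [T TE] := additive_of_morph TD.
  exists T; split=> [x y|x y].
    by rewrite !TE /= => /(can_inj KA)/(bij_inj bijB).
  by apply: (bij_inj bijC); rewrite -!ABC !TE /= !KA F'C.
have mulrI0 (x e : F) : e != 0 -> psf_mul x e = 0 -> x = 0.
  by move=> e0 /psf_mul_eq0[//|ee]; rewrite ee eqxx in e0.
have psf0r (e : F) : psf_mul 0 e = 0.
  by apply: (addrI (psf_mul 0 e)); rewrite -psf_mulDl !addr0.
have psfNr (x e : F) : psf_mul (- x) e = - psf_mul x e.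
  by apply: (addrI (psf_mul x e)); rewrite -psf_mulDl !subrr psf0r.
(* A nonzero e cancels; the trivial presemifield has none, but there 0 does. *)
have [e e_inj] : exists e : F, injective (fun x => psf_mul x e).
  case: (pickP [pred e : F | e != 0]) => [e /= e0|F0].
    exists e => x y /= xy; apply/eqP; rewrite -subr_eq0; apply/eqP.
    by apply: (mulrI0 _ e e0); rewrite psf_mulDl psfNr xy subrr.
  exists 0 => x y _.
  by move: (F0 x) (F0 y) => /= /negbFE/eqP-> /negbFE/eqP->.
pose M x := psf_mul (T x) e.
have M_inj : injective M by move=> x y /e_inj/T_inj.
have [M' MK KM] := injF_bij M_inj.
have MD : {morph M : x y / x + y}.
  by move=> x y; rewrite /M raddfD psf_mulDl.
have M'D : {morph M' : x y / x + y}.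
  by move=> x y; apply: M_inj; rewrite MD !KM.
have M0 : M 0 = 0 by rewrite /M raddf0 psf0r.
pose mul x y := psf_mul (T (M' x)) (M' y).
have mulDl : left_distributive mul +%R.
  by move=> x y z; rewrite /mul M'D raddfD psf_mulDl.
have mulDr : right_distributive mul +%R.
  by move=> x y z; rewrite /mul M'D psf_mulDr.
have mul_eq0 x y : mul x y = 0 -> x = 0 \/ y = 0.
  move=> /psf_mul_eq0[Tx|y0]; [left|right]; last by rewrite -(KM y) y0 M0.
  by rewrite -(KM x) /M Tx psf0r.
have mulC : commutative mul by move=> x y; exact: TC.
have mul1 : left_id (M e) mul by move=> x; rewrite /mul MK TC; exact: KM.
exists (Presemifield mulDl mulDr mul_eq0); split=> //.
  by exists (M e); split=> // x; rewrite /= mulC mul1.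
have AD : {morph (fun x : F => psf_mul x e) : x y / x + y}.
  by move=> x y; rewrite psf_mulDl.
have [A AE] := additive_of_morph AD.
have [B BE] := additive_of_morph MD.
(* M^-1 (x * e) = T^-1 x, hence the isotopism (x |-> x * e, M, id). *)
exists A, B, idfun; split=> [|||x y /=].
- by apply: injF_bij => x y; rewrite !AE => /e_inj.
- by apply: injF_bij => x y; rewrite !BE => /M_inj.
- by exists idfun.
rewrite /mul AE BE MK; congr psf_mul.
by apply: e_inj; exact: (KM (psf_mul x e)).
Qed.

(** * The symmetrizing maps are L-linear *)

(** The L-linear maps that are self-adjoint for x.1 y.2 + x.2 y.1. *)
Definition twist {L : finFieldType} (a b c : L) (x : L * L) : L * L :=
  (b * x.1 + c * x.2, a * x.1 + b * x.2).

(** The form x.1 y.2 + x.2 y.1 reads off the coordinates of T x when y runs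
    through the standard basis, and symmetry rewrites them as values of forms
    that are L-linear in x. *)
Lemma symmetric_twist {L : finFieldType} {T : L * L -> L * L} :
  (forall x y, (T x).1 * y.2 + (T x).2 * y.1 = (T y).1 * x.2 + (T y).2 * x.1) ->
  exists a b c, T =1 twist a b c.
Proof.
move=> TC; exists (T (1, 0)).2, (T (1, 0)).1, (T (0, 1)).1 => x.
have b01 := TC (0, 1) (1, 0).
have T1 := TC x (0, 1); have T2 := TC x (1, 0).
rewrite /= !(mulr0, mulr1, add0r, addr0) in b01 T1 T2.
rewrite [LHS]surjective_pairing /twist T1 T2 b01.
by congr pair; rewrite addrC.
Qed.

(** * The commutativity equations *)

(** The fixed points are roots of X^(p^s) - X, whose degree is less than #|L|. *)
Lemma frobenius_not_id {p m s : nat} {L : finFieldType} :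
  prime p -> #|L| = (p ^ m)%N -> (0 < s < m)%N ->
  exists z : L, z ^+ (p ^ s) != z.
Proof.
move=> p_prime card_L /andP[s0 sm]; apply/existsP.
rewrite -negb_forall; apply/negP => /forallP fix_all.
have q1 : (1 < p ^ s)%N by rewrite -(exp1n s) ltn_exp2r // prime_gt1.
have size_P : size ('X^(p ^ s) - 'X : {poly L}) = (p ^ s).+1.
  by rewrite size_polyDl size_polyXn // size_polyN size_polyX.
have P0 : ('X^(p ^ s) - 'X : {poly L}) != 0 by rewrite -size_poly_eq0 size_P.
have roots : all (root ('X^(p ^ s) - 'X)) (enum L).
  by apply/allP => x _; rewrite rootE !hornerE subr_eq0.
have := max_poly_roots P0 roots (enum_uniq L).
by rewrite size_P -cardE card_L ltnS leq_exp2l ?prime_gt1 // leqNgt sm.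
Qed.

(** Comparison of coefficients in the first coordinate; the second one is
    symmetric for every twist. *)
Lemma twist_symmetricP {p m s : nat} {L : finFieldType} (l n N a b c : L) :
  prime p -> #|L| = (p ^ m)%N -> (0 < s < m)%N ->
  let q := (p ^ s)%N in
  (forall x y, B_mul q l n N (twist a b c x) y
             = B_mul q l n N (twist a b c y) x)
  <-> c = n * b + l * n * b ^+ q - l * n * N * a ^+ q
      /\ B_commutativity_eqs q l n N (b, a).
Proof.
move=> p_prime card_L s_bounds q.
have frobD (x y : L) : (x + y) ^+ q = x ^+ q + y ^+ q.
  exact: frobenius_exprD p_prime card_L x y.
pose E1 := b - n * a - l * b ^+ q + l * n * N * a ^+ q.
pose E2 := c - n * b - l * n * b ^+ q + l * n * N * a ^+ q.
pose E3 := n * N * (b - a) - l * c ^+ q + l * n * N * b ^+ q.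
(* The coefficient for x.2 y.2^q is redundant: it combines the other three. *)
have hE x y : (B_mul q l n N (twist a b c x) y).1
            - (B_mul q l n N (twist a b c y) x).1
  = E1 * (x.1 * y.1 ^+ q - y.1 * x.1 ^+ q)
  + E2 * (x.2 * y.1 ^+ q - y.2 * x.1 ^+ q)
  + E3 * (x.1 * y.2 ^+ q - y.1 * x.2 ^+ q)
  + n * (N * E2 + E3 - N * E1) * (x.2 * y.2 ^+ q - y.2 * x.2 ^+ q).
  by rewrite /B_mul /B_h /= !frobD !exprMn /E1 /E2 /E3; ring.
have eqs : [/\ E1 = 0, E2 = 0 & E3 = 0] <->
    c = n * b + l * n * b ^+ q - l * n * N * a ^+ q
      /\ B_commutativity_eqs q l n N (b, a).
  have E1P : E1 = 0 <-> b = l * b ^+ q + n * a - l * n * N * a ^+ q.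
    rewrite (_ : E1 = b - (l * b ^+ q + n * a - l * n * N * a ^+ q)).
      by split=> [/subr0_eq //|<-]; rewrite subrr.
    by rewrite /E1; ring.
  have E2P : E2 = 0 <-> c = n * b + l * n * b ^+ q - l * n * N * a ^+ q.
    rewrite (_ : E2 = c - (n * b + l * n * b ^+ q - l * n * N * a ^+ q)).
      by split=> [/subr0_eq //|<-]; rewrite subrr.
    by rewrite /E2; ring.
  have E3P : E3 = 0 <->
      l * c ^+ q = n * N * b + l * n * N * b ^+ q - n * N * a.
    rewrite (_ : E3 = n * N * b + l * n * N * b ^+ q - n * N * a - l * c ^+ q).
      by split=> [/subr0_eq //|->]; rewrite subrr.
    by rewrite /E3; ring.
  rewrite /B_commutativity_eqs /=.
  split=> [[/E1P e1 /E2P e2 /E3P e3]|[e2 [e3 e1]]].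
    by rewrite -e2; do !split.
  by rewrite -e2 in e3; split; [apply/E1P|apply/E2P|apply/E3P].
rewrite -eqs; split=> [TC|[e1 e2 e3] x y]; last first.
  apply: injective_projections; last by rewrite /=; ring.
  by apply: subr0_eq; rewrite hE e1 e2 e3; ring.
have q0 : (0 < q)%N by rewrite expn_gt0 prime_gt0.
have frob0 : (0 : L) ^+ q = 0 by rewrite expr0n eqn0Ngt q0.
have [z zq] := frobenius_not_id p_prime card_L s_bounds.
have {hE}E0 x y := etrans (esym (hE x y))
   (etrans (congr1 (fun t => t.1 - _) (TC x y)) (subrr _)).
(* A suitable x = (z, 0) isolates E1, and x = (0, t) mixes E2 and E3. *)
have e1 : E1 = 0.
  have := E0 (z, 0) (1, 0); rewrite /= frob0 expr1n.
  rewrite !(mulr0, mul0r, subr0, addr0, mulr1, mul1r) => /eqP.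
  by rewrite mulf_eq0 subr_eq0 [z == _]eq_sym (negPf zq) orbF => /eqP.
have e23 t : E2 * t = E3 * t ^+ q.
  have := E0 (0, t) (1, 0); rewrite /= frob0 expr1n e1 => h.
  by apply: subr0_eq; rewrite -h; ring.
have e2E3 : E2 = E3 by have := e23 1; rewrite expr1n !mulr1.
have e3 : E3 = 0.
  have /eqP := e23 z; rewrite e2E3 -subr_eq0 -mulrBr mulf_eq0 subr_eq0.
  by rewrite [z == _]eq_sym (negPf zq) orbF => /eqP.
by rewrite e2E3.
Qed.

(** * Explicit solutions *)

(** In the equations, as in the formula for f, each q-th power comes with one
    factor l, which absorbs the surplus z^(q - 1) in z^q. *)
Lemma B_commutativity_eqs_scale {L : finFieldType} {q : nat} {l n N z : L}
    (v : L * L) :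
  (0 < q)%N -> z != 0 -> B_commutativity_eqs q l n N v ->
  B_commutativity_eqs q (z ^+ (q - 1) * l) n N (v.1 / z, v.2 / z).
Proof.
move=> q0 z0; rewrite /B_commutativity_eqs /=.
have zq : z ^+ q = z ^+ (q - 1) * z by rewrite -exprSr subn1 prednK.
set w := z ^+ (q - 1) in zq *.
have w0 : w != 0 by rewrite expf_neq0.
set f := (X in l * X ^+ q); set f' := (X in w * l * X ^+ q).
have -> : f' = f / z.
  by rewrite /f' /f !exprMn !exprVn zq; field; rewrite z0 w0.
rewrite !exprMn !exprVn zq => -[eq1 eq2]; split.
  rewrite (_ : w * l * _ = (l * f ^+ q) / z); last by field; rewrite z0 w0.
  by rewrite eq1; field; rewrite z0 w0.
by rewrite [in LHS]eq2; field; rewrite z0 w0.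
Qed.

Lemma B_commutativity_eqs_invN (L : finFieldType) (q : nat) (n N : L) :
  odd q -> n != 0 -> N != 0 -> N ^+ 2 = n ^+ (q - 1) ->
  B_commutativity_eqs q N^-1 n N (0, 1).
Proof.
move=> q_odd n0 N0 NE; rewrite /B_commutativity_eqs /=.
have q0 := odd_gt0 q_odd.
have nq : n ^+ q = N ^+ 2 * n by rewrite NE -exprSr subn1 prednK.
rewrite (expr0n L q) eqn0Ngt q0 expr1n !mulr0 !mulr1 !add0r; split.
  rewrite (_ : - _ = - n); last by field.
  by rewrite exprNn -signr_odd q_odd nq; field.
by field.
Qed.

(** With l = 1 and N = n^(q - 1), we have n N = n^q, so the second equation
    says that b - n a is fixed by the q-th power map, for v = (b, a).  Writing
    c for this difference and eliminating a turns the first equation into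
    phi b = (N - 1) c. *)
Lemma B_commutativity_eqs_one {p m : nat} (s : nat) {L : finFieldType} {n : L} :
  prime p -> #|L| = (p ^ m)%N -> n != 0 ->
  let q := (p ^ s)%N in
  exists2 v : L * L, v != 0 & B_commutativity_eqs q 1 n (n ^+ (q - 1)) v.
Proof.
move=> p_prime card_L n0 q.
have q0 : (0 < q)%N by rewrite expn_gt0 prime_gt0.
have frobD (x y : L) : (x + y) ^+ q = x ^+ q + y ^+ q.
  exact: frobenius_exprD p_prime card_L x y.
have frob0 : (0 : L) ^+ q = 0 by rewrite expr0n eqn0Ngt q0.
have frobN (x : L) : (- x) ^+ q = - x ^+ q.
  by apply/eqP; rewrite -addr_eq0 -frobD addNr frob0.
set N := n ^+ (q - 1).
have nq : n ^+ q = N * n by rewrite -exprSr subn1 prednK.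
pose phi b := ((n - 1) * b ^+ q) ^+ q - N * (n - 1) * b.
have sol b c : c ^+ q = c -> phi b = (N - 1) * c ->
    B_commutativity_eqs q 1 n N (b, (b - c) / n).
  move=> cq phiE.
  have Nv : n * N * ((b - c) / n) ^+ q = b ^+ q - c.
    by rewrite exprMn exprVn frobD frobN cq nq; field; rewrite n0 expf_neq0.
  rewrite /B_commutativity_eqs /= !mul1r Nv; split; last by field.
  apply: subr0_eq; rewrite -(subrr ((N - 1) * c)) -{1}phiE /phi.
  by rewrite !(frobD, frobN, exprMn, expr1n) cq nq; field.
case: (pickP [pred b | (b != 0) && (phi b == 0)])
  => [b /andP[b0 /eqP phib]|kerphi].
  exists (b, (b - 0) / n); first by rewrite xpair_eqE negb_and b0.
  by apply: sol; rewrite ?frob0 // phib mulr0.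
have phi_inj : injective phi.
  move=> x y xy; apply/eqP; rewrite -subr_eq0.
  have /= := kerphi (x - y); rewrite andbC (_ : phi _ == 0); first by case: eqP.
  apply/eqP; rewrite -(subrr (phi y)) -{1}xy /phi.
  by rewrite !(frobD, frobN, exprMn); ring.
have [psi _ phiK] := injF_bij phi_inj.
exists (psi (N - 1), (psi (N - 1) - 1) / n); last first.
  by apply: sol; rewrite ?phiK ?expr1n ?mulr1.
rewrite xpair_eqE; apply/negP => /andP[/eqP-> /eqP/esym].
by move/eqP; rewrite sub0r eq_sym mulf_eq0 invr_eq0 oppr_eq0 oner_eq0 (negPf n0).
Qed.

Theorem theorem7p11 (p m s : nat) (L : finFieldType) (l n N : L)
    (p_prime : prime p) (p_odd : odd p) (card_L : #|L| = (p ^ m)%N)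
    (s_bounds : (0 < s < m)%N)
    (l_neq0 : l != 0) (n_neq0 : n != 0) (N_neq0 : N != 0)
    (l_notin : - l \notin powers L (p ^ s - 1))
    (no_root : forall x : L,
       x ^+ (p ^ s + 1) + (1 - N^-1) * x + (n^-1 - 1) / N != 0) :
  (isotopic_to_commutative_semifield
     (B p_prime card_L n_neq0 N_neq0 l_notin no_root)
   <-> exists v : L * L, v != 0 /\ B_commutativity_eqs (p ^ s) l n N v)
  /\ ((N ^+ 2 = n ^+ (p ^ s - 1)
       /\ l \in [set N^-1 * y | y in powers L (p ^ s - 1)])
      \/ (N = n ^+ (p ^ s - 1) /\ l \in powers L (p ^ s - 1))
      -> exists v : L * L, v != 0 /\ B_commutativity_eqs (p ^ s) l n N v).
Proof.
split.
  rewrite isotopic_to_commutative_semifieldP; split=> [[T [T_inj TC]]|].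
    have [a [b [c TE]]] : exists a b c, T =1 twist a b c.
      by apply: symmetric_twist => x y; have /(congr1 snd) := TC x y.
    have TwC x y : B_mul (p ^ s) l n N (twist a b c x) y
                 = B_mul (p ^ s) l n N (twist a b c y) x.
      by rewrite -!TE; exact: TC.
    have [cE eqs] :=
      (twist_symmetricP l n N a b c p_prime card_L s_bounds).1 TwC.
    exists (b, a); split=> //; apply/eqP => -[b0 a0].
    have q_neq0 : (p ^ s)%N != 0%N by rewrite -lt0n expn_gt0 prime_gt0.
    have c0 : c = 0.
      by rewrite cE a0 b0 expr0n (negPf q_neq0) !mulr0 addr0 subr0.
    have T0 x : T x = (0, 0).
      by rewrite TE a0 b0 c0 /twist !mul0r addr0.
    have /(congr1 fst)/= /eqP :=
      T_inj (1, 0) (0, 0) (etrans (T0 _) (esym (T0 _))).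
    by rewrite oner_eq0.
  move=> [[b a] [v0 eqs]].
  pose c := n * b + l * n * b ^+ (p ^ s) - l * n * N * a ^+ (p ^ s).
  have TwC := (twist_symmetricP l n N a b c p_prime card_L s_bounds).2
    (conj erefl eqs).
  have twD : {morph twist a b c : x y / x + y}.
    by move=> x y; apply: injective_projections; rewrite /=; ring.
  have twN x : twist a b c (- x) = - twist a b c x.
    by apply: injective_projections; rewrite /=; ring.
  have [T TE] := additive_of_morph twD.
  exists T; split=> x y; last by rewrite !TE; exact: TwC.
  (* If T kills x - y, then v * (x - y) = 0, because T (1, 0) = v. *)
  rewrite !TE => xy; apply/eqP; rewrite -subr_eq0; apply/eqP.
  have tw0 : twist a b c (x - y) = 0 by rewrite twD twN xy subrr.
  have := TwC (1, 0) (x - y); rewrite tw0.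
  have -> : B_mul (p ^ s) l n N 0 (1, 0) = 0.
    apply: injective_projections; rewrite /= ?/B_h ?(expr0n L (p ^ s));
      by rewrite ?eqn0Ngt ?expn_gt0 ?prime_gt0 //=; ring.
  case/(B_mul_eq0 p_prime card_L n_neq0 N_neq0 l_notin no_root) => //.
  rewrite /twist /= !mulr1 !mulr0 !addr0 => ba0.
  by rewrite ba0 eqxx in v0.
have q0 : (0 < p ^ s)%N by rewrite expn_gt0 prime_gt0.
have q1 : (0 < p ^ s - 1)%N.
  by rewrite subn_gt0 -(exp1n s) ltn_exp2r ?prime_gt1 //; case/andP: s_bounds.
have neq0 (k z : L) : l = z ^+ (p ^ s - 1) * k -> z != 0.
  by move=> lE; apply: contraNneq l_neq0 => z0; rewrite lE z0 expr0n gtn_eqF ?mul0r.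
case=> [[NE /imsetP[_ /imsetP[z _ ->] lE]]|[NE /imsetP[z _ lE]]].
  have z0 : z != 0 by apply: (neq0 N^-1); rewrite lE mulrC.
  exists (0 / z, 1 / z); split.
    by rewrite xpair_eqE /= mul0r eqxx mul1r invr_eq0.
  rewrite lE mulrC.
  apply: (B_commutativity_eqs_scale (0, 1)) => //.
  by apply: B_commutativity_eqs_invN => //; rewrite oddX p_odd orbT.
have z0 : z != 0 by apply: (neq0 1); rewrite mulr1.
have [v v0 eqs] := B_commutativity_eqs_one s p_prime card_L n_neq0.
exists (v.1 / z, v.2 / z); split; last first.
  by rewrite lE -[_ ^+ _]mulr1 NE; apply: B_commutativity_eqs_scale.
move: v0; rewrite [v]surjective_pairing !xpair_eqE /=.
by rewrite !mulf_eq0 !invr_eq0 (negPf z0) !orbF.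
Qed.
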